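(* Let $M$ be a proper set system over a finite ground set $V$. Then $M$ is a delta-matroid if and only if $M$ is isodistant, i.e., if and only if for each $X \subseteq V$ all sets in $\min(M*X)$ have equal cardinality.
   Context: A set system is a pair $M=(V,D)$ with $V$ a finite set (the ground set) and $D$ a family of subsets of $V$; it is proper if $D\neq\varnothing$. We write $Y\in M$ for $Y\in D$. $\triangle$ denotes symmetric difference. For $X\subseteq V$, the pivot (twist) of $M$ on $X$ is $M*X=(V,\{Y\triangle X \mid Y\in D\})$. $\min(M)$ is the set system on $V$ whose sets are the members of $D$ that are minimal with respect to inclusion. A set system is equicardinal if all its sets have the same cardinality. A proper set system $M$ is isodistant if $\min(M*X)$ is equicardinal for each $X\subseteq V$. A delta-matroid is a proper set system $M$ satisfying the symmetric exchange axiom: for all $X,Y\in M$ and all $u\in X\triangle Y$, either $X\triangle\{u\}\in M$ or there is a $v\in X\triangle Y$ with $v\neq u$ such that $X\triangle\{u,v\}\in M$. *)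

(* Defs.v *)
From mathcomp Require Import all_boot.

Set Implicit Arguments.
Unset Strict Implicit.
Unset Printing Implicit Defensive.

(* The ground set is the whole (possibly empty) finite type V, so a set system
   on V is its family of sets D : {set {set V}}, and [Y \in D] is membership. *)
Notation set_system V := {set {set V}}.

Definition symdiff (V : finType) (A B : {set V}) : {set V} :=
  (A :\: B) :|: (B :\: A).

Definition proper_system (V : finType) (M : set_system V) : Prop := M != set0.

Definition pivot (V : finType) (M : set_system V) (X : {set V}) :
  set_system V := [set symdiff Y X | Y in M].

Definition min_system (V : finType) (M : set_system V) : set_system V :=
  [set Y | minset (fun Z => Z \in M) Y].

Definition equicardinal (V : finType) (M : set_system V) : Prop :=
  forall A B : {set V}, A \in M -> B \in M -> #|A| = #|B|.

Definition isodistant (V : finType) (M : set_system V) : Prop :=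
  proper_system M /\
  forall X : {set V}, equicardinal (min_system (pivot M X)).

Definition symmetric_exchange (V : finType) (M : set_system V) : Prop :=
  forall X Y : {set V}, X \in M -> Y \in M ->
  forall u : V, u \in symdiff X Y ->
  symdiff X [set u] \in M \/
  exists v : V, [/\ v \in symdiff X Y, v != u & symdiff X [set u; v] \in M].

Definition delta_matroid (V : finType) (M : set_system V) : Prop :=
  proper_system M /\ symmetric_exchange M.

(* Main.v *)
(** In a delta-matroid, exchanging an element of [A \ B], where [A] has least
    cardinality and [B] is minimal, yields a set of least cardinality closer to
    [B]; hence [#|A| = #|B|].  Applied to every pivot, which is again a
    delta-matroid, this gives one direction.  Conversely, pivot [X] to the empty
    set and let [W] be minimal among the members containing [u] and contained
    in [Y].  If [{u}] is not a member, then pivoting on [{u}] makes [{u}] and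
    [W \ {u}] both minimal, so [#|W| = 2]. *)
Require Import Defs.
From mathcomp Require Import all_boot.

Lemma in_symdiff {V : finType} (A B : {set V}) x :
  (x \in symdiff A B) = (x \in A) (+) (x \in B).
Proof. by rewrite !inE; case: (x \in A); case: (x \in B). Qed.

Lemma symdiffA {V : finType} : associative (@symdiff V).
Proof. by move=> A B C; apply/setP=> x; rewrite !in_symdiff addbA. Qed.

Lemma symdiffC {V : finType} : commutative (@symdiff V).
Proof. by move=> A B; apply/setP=> x; rewrite !in_symdiff addbC. Qed.

Lemma symdiff0 {V : finType} : right_id set0 (@symdiff V).
Proof. by move=> A; apply/setP=> x; rewrite in_symdiff inE addbF. Qed.

Lemma symdiffv {V : finType} (A : {set V}) : symdiff A A = set0.
Proof. by apply/setP=> x; rewrite in_symdiff inE addbb. Qed.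

Lemma symdiffK {V : finType} (X : {set V}) : involutive ((@symdiff V)^~ X).
Proof. by move=> A; rewrite /= -symdiffA symdiffv symdiff0. Qed.

Lemma symdiffAC {V : finType} : right_commutative (@symdiff V).
Proof. by move=> A B C; rewrite -!symdiffA (symdiffC B). Qed.

Lemma symdiff_subset {V : finType} (A B : {set V}) :
  B \subset A -> symdiff A B = A :\: B.
Proof. by rewrite -setD_eq0 /symdiff => /eqP->; rewrite setU0. Qed.

Lemma mem_pivot {V : finType} (M : set_system V) (X Z : {set V}) :
  (Z \in pivot M X) = (symdiff Z X \in M).
Proof.
rewrite -{1}(symdiffK X Z).
exact: (mem_imset M (symdiff Z X) (inv_inj (symdiffK X))).
Qed.

Lemma pivot_comp {V : finType} (M : set_system V) (X Y : {set V}) :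
  pivot (pivot M X) Y = pivot M (symdiff X Y).
Proof. by apply/setP=> Z; rewrite !mem_pivot -symdiffA (symdiffC Y). Qed.

Lemma min_systemP {V : finType} (M : set_system V) (A : {set V}) :
  reflect (A \in M /\ forall B, B \in M -> B \subset A -> B = A)
          (A \in min_system M).
Proof. by rewrite inE; exact: minsetP. Qed.

(** Twisting both members by [Z] leaves their symmetric difference unchanged, so an exchange in [M]
    carries over verbatim. *)
Lemma symmetric_exchange_pivot {V : finType} (M : set_system V) (Z : {set V}) :
  symmetric_exchange M -> symmetric_exchange (pivot M Z).
Proof.
move=> exM X Y; rewrite !mem_pivot => XM YM u.
have XY : symdiff (symdiff X Z) (symdiff Y Z) = symdiff X Y.
  by rewrite (symdiffC Y) symdiffA symdiffK.
rewrite -{1}XY => /(exM _ _ XM YM) [uM | [v [vXY vu uvM]]].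
  by left; rewrite mem_pivot symdiffAC.
by right; exists v; rewrite mem_pivot symdiffAC -XY.
Qed.

(** Induction on [#|A :\: B|]: the exchange swaps some [u] in [A :\: B] for a [v] in [B :\: A],
    preserving [#|A|]. Once [A] lies inside [B], minimality of [B] gives [A = B]. *)
Lemma card_min_system {V : finType} (M : set_system V) (A B : {set V}) :
  symmetric_exchange M -> A \in M -> (forall C, C \in M -> #|A| <= #|C|) ->
  B \in min_system M -> #|A| = #|B|.
Proof.
move=> exM + + /min_systemP[BM minB].
have [n] := ubnP #|A :\: B|; elim: n A => // n IHn A ltn AM minA.
have [sAB | ] := boolP (A \subset B); first by rewrite (minB A).
case/subsetPn=> u uA uB.
have uAB : u \in symdiff A B by rewrite in_symdiff uA (negbTE uB).
(* Deleting [C] would give a member smaller than [A]. This excludes dropping [u] alone, and dropping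
   [u] together with another element of [A]. *)
have noSub (C : {set V}) : C \subset A -> u \in C -> symdiff A C \notin M.
  move=> sCA uC; rewrite symdiff_subset //; apply/negP => /minA.
  rewrite leqNgt => /negP[]; apply/proper_card/properP.
  by split; [exact: subsetDl | exists u; rewrite // inE uC].
case: (exM A B AM BM u uAB) => [|[v [vAB vu A'M]]].
  by rewrite (negbTE (noSub _ _ _)) ?sub1set ?set11.
have vA : v \notin A.
  apply/negP=> vA; move: A'M; apply/negP/noSub; last by rewrite !inE eqxx.
  by apply/subsetP=> x /set2P[]->.
have vB : v \in B by move: vAB; rewrite in_symdiff (negbTE vA).
have eA' : symdiff A [set u; v] = v |: (A :\ u).
  apply/setP=> x; rewrite in_symdiff !inE.
  have [->|xv] := eqVneq x v; first by rewrite orbT (negbTE vA).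
  by have [->|_] := eqVneq x u; rewrite ?uA ?addbF.
have cA' : #|symdiff A [set u; v]| = #|A|.
  by rewrite eA' cardsU1 !inE (negbTE vA) andbF (cardsD1 u A) uA.
rewrite -cA'; apply: IHn => // [|C CM]; last by rewrite cA' minA.
(* The difference with [B] loses [u] and does not gain [v], which lies in [B]. *)
rewrite -ltnS; apply: leq_trans ltn; rewrite ltnS; apply/proper_card/properP.
rewrite eA'; split; last first.
  by exists u; rewrite !inE ?uB ?uA // eqxx orbF eq_sym (negbTE vu) andbF.
apply/subsetP=> x; rewrite !inE => /andP[xB /orP[/eqP xv|/andP[_ ->]]].
  by rewrite xv vB in xB.
by rewrite xB.
Qed.

Lemma equicardinal_min_system {V : finType} (M : set_system V) :
  symmetric_exchange M -> equicardinal (min_system M).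
Proof.
move=> exM B C minB minC; have [BM _] := min_systemP _ _ minB.
(* Both minimal sets are compared with one member of least cardinality. *)
have [A AM leA] := arg_minnP (fun Z : {set V} => #|Z|) BM.
by rewrite -(card_min_system M A B) // -(card_min_system M A C).
Qed.

(** This is the exchange axiom at the empty set, to which a pivot reduces the general case. *)
Lemma isodistant_exchange0 {V : finType} (M : set_system V) (Y : {set V}) u :
  equicardinal (min_system (pivot M [set u])) ->
  set0 \in M -> Y \in M -> u \in Y ->
  [set u] \in M \/ exists v, [/\ v \in Y, v != u & [set u; v] \in M].
Proof.
move=> eqM M0 YM uY; have [|uM] := boolP ([set u] \in M); [by left | right].
pose P Z := (Z \in M) && (u \in Z).
have PY : P Y by rewrite /P YM.
have [W /minsetP[/andP[WM uW] minW] sWY] := minset_exists PY.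
have min_u : [set u] \in min_system (pivot M [set u]).
  apply/min_systemP; rewrite mem_pivot symdiffv; split=> // B.
  rewrite mem_pivot subset1 => BM /orP[/eqP//|/eqP B0].
  by rewrite B0 symdiffC symdiff0 (negbTE uM) in BM.
have min_W : W :\ u \in min_system (pivot M [set u]).
  have eW : symdiff W [set u] = W :\ u by rewrite symdiff_subset ?sub1set.
  (* A competitor [B] inside [W :\ u] misses [u], so adding [u] gives a member of [M] that contains
     [u] and lies in [W]; by the choice of [W] it equals [W]. *)
  apply/min_systemP; rewrite mem_pivot -eW symdiffK; split=> // B.
  rewrite mem_pivot eW => BM /subsetD1P[sBW uB].
  rewrite -eW -(minW (symdiff B [set u])) ?symdiffK //.
    by rewrite /P BM in_symdiff set11 (negbTE uB).
  apply/subsetP=> x; rewrite in_symdiff inE.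
  by have [->|_] := eqVneq x u; rewrite ?uW // addbF; apply: (subsetP sBW).
have := eqM _ _ min_u min_W; rewrite cards1 => /esym/eqP/cards1P[v eWv].
have /setD1P[vu vW] : v \in W :\ u by rewrite eWv set11.
by exists v; rewrite (subsetP sWY) // -eWv setD1K.
Qed.

Theorem theorem4p2 (V : finType) (M : set_system V) (hM : proper_system M) :
  delta_matroid M <-> isodistant M.
Proof.
split=> [[_ exM]|[_ isoM]]; split=> //.
  by move=> X; exact/equicardinal_min_system/symmetric_exchange_pivot.
move=> X Y XM YM u uXY.
have eqM : equicardinal (min_system (pivot (pivot M X) [set u])).
  by rewrite pivot_comp.
(* In [pivot M X], the empty set stands for [X] and [symdiff X Y] for [Y]. *)
have := isodistant_exchange0 (pivot M X) (symdiff X Y) u eqM.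
rewrite !mem_pivot (symdiffC set0) symdiff0 (symdiffC X) symdiffK.
rewrite (symdiffC [set u]) (symdiffC Y) => /(_ XM YM uXY) [|[v [vXY vu uvM]]].
  by left.
by right; exists v; split=> //; rewrite symdiffC -mem_pivot.
Qed.
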